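(* Let $\mathfrak{g}$ be a finite-dimensional Loday algebra, and let $\vdash_\star,\dashv_\star$ be the associative dialgebra multiplications on $\mathcal{A}^{poly}_\star(\mathfrak{g}^* )=S_\star(\mathfrak{g}_{Lie})\otimes\mathfrak{g}$ defined in the context, with dialgebra commutator $[a,b]_{di}:=a\vdash_\star b-b\dashv_\star a$. Then for any $f\otimes x,\ g\otimes y\in\mathcal{A}^{poly}_\star(\mathfrak{g}^* )$, $$\lim_{\hbar\to0}(f\otimes x)\vdash_\star(g\otimes y)=(f\otimes x)*(g\otimes y),$$ $$\lim_{\hbar\to0}\frac1\hbar[f\otimes x,g\otimes y]_{di}=\{f\otimes x,g\otimes y\},$$ where $*$ and $\{\cdot,\cdot\}$ are the multiplication and bracket of the Loday-Poisson algebra $\mathcal{A}^{poly}(\mathfrak{g}^* )=S(\mathfrak{g}_{Lie})\otimes\mathfrak{g}$. (Here $\lim_{\hbar\to0}$ means taking the $\hbar^0$-coefficient, the commutator $[f\otimes x,g\otimes y]_{di}$ being divisible by $\hbar$; if $f,g$ depend on $\hbar$, the right-hand sides are taken at $\hbar=0$.)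
   Context: The ground field is $k=\mathbb{R}$ (or $\mathbb{C}$); $\hbar$ is a formal parameter, and tensor products and enveloping algebras over $k[[\hbar]]$ are understood $\hbar$-adically completed. A Loday (Leibniz) algebra is a vector space $\mathfrak{g}$ with a bilinear bracket satisfying $[x,[y,z]]=[[x,y],z]+[y,[x,z]]$. Let $\mathfrak{g}^{ann}$ be the span of all $[x,y]+[y,x]$, a two-sided ideal; $\mathfrak{g}_{Lie}:=\mathfrak{g}/\mathfrak{g}^{ann}$ is a Lie algebra, $\bar x$ denotes the image of $x$, and $[x,y]$ depends on $x$ only through $\bar x$. Loday-Poisson algebra: $S(\mathfrak{g}_{Lie})$ is the symmetric algebra with its Lie-Poisson bracket. On $\mathcal{A}^{poly}(\mathfrak{g}^* ):=S(\mathfrak{g}_{Lie})\otimes\mathfrak{g}$ put $(f\otimes x)*(g\otimes y):=f\bar xg\otimes y$; $\{\bar x_1\cdots\bar x_n,y\}:=\sum_i\bar x_1\cdots\bar x_{i-1}\bar x_{i+1}\cdots\bar x_n\otimes[x_i,y]$; $\{f,g\otimes y\}:=\{f,g\}\otimes y+g\{f,y\}$ with $g(h\otimes z)=gh\otimes z$; $\{f\otimes x,g\otimes y\}:=\{f\bar x,g\otimes y\}$. An associative dialgebra is a vector space $D$ with two associative multiplications $\vdash,\dashv$ such that $(a\vdash b)\vdash c=(a\dashv b)\vdash c$, $(a\vdash b)\dashv c=a\vdash(b\dashv c)$, $a\dashv(b\dashv c)=a\dashv(b\vdash c)$. Universal enveloping dialgebra: let $U_\hbar(\mathfrak{g}_{Lie})$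 be the universal enveloping algebra of $\mathfrak{g}_{Lie}$ with Lie bracket $\hbar[\cdot,\cdot]$ (so $\bar x\bar y-\bar y\bar x=\hbar[\bar x,\bar y]$), and let $Ud_\hbar(\mathfrak{g}):=U_\hbar(\mathfrak{g}_{Lie})\otimes\mathfrak{g}$ be the universal enveloping dialgebra of $\mathfrak{g}$ with Loday bracket $\hbar[\cdot,\cdot]$, whose multiplications are $(f\otimes x)\vdash(g\otimes y):=f\bar xg\otimes y$; $(f\otimes x)\dashv(1\otimes y):=f\bar y\otimes x-f\otimes\hbar[y,x]$; $(f\otimes x)\dashv(\bar y_1\cdots\bar y_{n-1}\otimes y_n):=(\cdots((f\otimes x)\dashv(1\otimes y_1))\dashv\cdots)\dashv(1\otimes y_n)$. Star product: $S_\star(\mathfrak{g}_{Lie}):=(S(\mathfrak{g}_{Lie})[[\hbar]],\star)$ is Kontsevich's canonical deformation quantization of the Lie-Poisson algebra $S(\mathfrak{g}_{Lie})$. It is an associative $k[[\hbar]]$-bilinear product with $f\star g=fg+\frac{\hbar}{2}\{f,g\}+O(\hbar^2)$ and $\bar x\star\bar y=\bar x\bar y+\frac{\hbar}{2}[\bar x,\bar y]$ for $\bar x,\bar y\in\mathfrak{g}_{Lie}$. There is an algebra isomorphism $I:U_\hbar(\mathfrak{g}_{Lie})\to S_\star(\mathfrak{g}_{Lie})$ with $I(\bar x)=\bar x$ on generators. The multiplications $\vdash_\star,\dashv_\star$ on $\mathcal{A}^{poly}_\star(\mathfrak{g}^* ):=S_\star(\mathfrak{g}_{Lie})\otimes\mathfrak{g}$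 are those obtained by transporting $\vdash,\dashv$ from $Ud_\hbar(\mathfrak{g})$ along the linear isomorphism $I\otimes1$. *)

(* Defs.v *)
From HB Require Import structures.
From mathcomp Require Import all_boot all_order all_algebra.
From mathcomp Require Import generic_quotient ring_quotient sesquilinear.
From mathcomp Require Import boolp reals complex.
From mathcomp Require Import ring monalg mpoly.

Set Implicit Arguments.
Unset Strict Implicit.
Unset Printing Implicit Defensive.

Import GRing.Theory.
Local Open Scope ring_scope.
Local Open Scope quotient_scope.

Variant ground := Reals | Complexes.

Definition ground_field (R : realType) (c : ground) : fieldType :=
  match c with Reals => R | Complexes => R[i] end.

(* Formal power series in hbar with coefficients in V; F n is the coefficient
   of hbar^n. *)
Definition fps (V : Type) : Type := nat -> V.

HB.instance Definition _ (V : Type) := gen_eqMixin (fps V).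
HB.instance Definition _ (V : Type) := gen_choiceMixin (fps V).

Section FpsZmodule.
Variable V : zmodType.
Implicit Types F G H : fps V.

Definition fps0 : fps V := fun=> 0.
Definition fpsD F G : fps V := fun n => F n + G n.
Definition fpsN F : fps V := fun n => - F n.

Fact fpsDA : associative fpsD.
Proof. by move=> F G H; apply/funext => n; rewrite /fpsD addrA. Qed.
Fact fpsDC : commutative fpsD.
Proof. by move=> F G; apply/funext => n; rewrite /fpsD addrC. Qed.
Fact fps0D : left_id fps0 fpsD.
Proof. by move=> F; apply/funext => n; rewrite /fpsD add0r. Qed.
Fact fpsND : left_inverse fps0 fpsN fpsD.
Proof. by move=> F; apply/funext => n; rewrite /fpsD addNr. Qed.

HB.instance Definition _ := GRing.isZmodule.Build (fps V) fpsDA fpsDC fps0D fpsND.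

Lemma fps0E n : (0 : fps V) n = 0. Proof. by []. Qed.
Lemma fpsDE F G n : (F + G) n = F n + G n. Proof. by []. Qed.
Lemma fpsNE F n : (- F) n = - F n. Proof. by []. Qed.

Definition fpsC (v : V) : fps V := fun n => if n is 0%N then v else 0.

Lemma fpsCD u v : fpsC (u + v) = fpsC u + fpsC v.
Proof. by apply/funext => -[|n]; rewrite fpsDE //= addr0. Qed.
Lemma fpsCN u : fpsC (- u) = - fpsC u.
Proof. by apply/funext => -[|n]; rewrite fpsNE //= oppr0. Qed.
End FpsZmodule.

Lemma sum_triangle (V : nmodType) (E : nat -> nat -> V) n :
  \sum_(i < n.+1) \sum_(j < (n - i).+1) E i j
    = \sum_(j < n.+1) \sum_(i < j.+1) E i (j - i)%N.
Proof.
transitivity (\sum_(i < n.+1) \sum_(j < n.+1 | (i <= j)%N) E i (j - i)%N).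
  apply: eq_bigr => -[i /= ilen] _.
  have lein : (i <= n)%N by [].
  rewrite -(big_geq_mkord _ _ predT (fun j => E i (j - i)%N)).
  rewrite [RHS]/= -[X in \sum_(X <= _ < _) _]add0n big_addn subSn // big_mkord.
  by apply: eq_bigr => j _; rewrite addnK.
rewrite (exchange_big_dep predT) //=; apply: eq_bigr => j _.
by rewrite [RHS](big_ord_widen n.+1 (fun i => E i (j - i)%N) (ltn_ord j)).
Qed.

HB.lock Definition fpsM (R : nzRingType) (F G : fps R) : fps R :=
  fun n => \sum_(i < n.+1) F i * G (n - i)%N.

Section FpsRing.
Variable R : nzRingType.
Implicit Types F G H : fps R.
Local Notation fpsM := (@fpsM R).

Fact fpsMA : associative fpsM.
Proof.
move=> F G H; apply/funext => n; rewrite fpsM.unlock.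
under eq_bigr do rewrite mulr_sumr.
under [RHS]eq_bigr do rewrite mulr_suml.
rewrite (sum_triangle (fun i j => F i * (G j * H (n - i - j)%N))).
apply: eq_bigr => j _; apply: eq_bigr => -[i /= ilej] _.
by rewrite -subnDA subnKC // mulrA.
Qed.

Fact fps1M : left_id (fpsC 1) fpsM.
Proof.
move=> F; apply/funext => n; rewrite fpsM.unlock big_ord_recl /= mul1r subn0.
by rewrite big1 ?addr0 // => i _; rewrite mul0r.
Qed.

Fact fpsM1 : right_id (fpsC 1) fpsM.
Proof.
move=> F; apply/funext => n; rewrite fpsM.unlock big_ord_recr /= subnn mulr1.
rewrite big1 ?add0r // => -[i /= ilen] _.
by case: (n - i)%N (subn_gt0 i n) => [|k _]; rewrite ?ilen //= mulr0.
Qed.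

Fact fpsMDl : left_distributive fpsM +%R.
Proof.
move=> F G H; apply/funext => n; rewrite fpsDE fpsM.unlock -big_split /=.
by apply: eq_bigr => i _; rewrite mulrDl.
Qed.

Fact fpsMDr : right_distributive fpsM +%R.
Proof.
move=> F G H; apply/funext => n; rewrite fpsDE fpsM.unlock -big_split /=.
by apply: eq_bigr => i _; rewrite mulrDr.
Qed.

Fact fps1_neq0 : fpsC 1 != 0 :> fps R.
Proof. by apply/eqP => /(congr1 (fun F => F 0%N)) /= /eqP; rewrite oner_eq0. Qed.

HB.instance Definition _ := GRing.Zmodule_isNzRing.Build (fps R)
  fpsMA fps1M fpsM1 fpsMDl fpsMDr fps1_neq0.

Lemma fpsME F G n : (F * G) n = \sum_(i < n.+1) F i * G (n - i)%N.
Proof. by rewrite -[LHS]/(fpsM F G n) fpsM.unlock. Qed.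

Lemma fps0M F G : (F * G) 0%N = F 0%N * G 0%N.
Proof. by rewrite fpsME big_ord1. Qed.

Definition hbar : fps R := fun n => (n == 1%N)%:R.
End FpsRing.
Arguments hbar {R}.

Section FpsComRing.
Variable R : comNzRingType.

Fact fpsMC : commutative (@fpsM R).
Proof.
move=> F G; apply/funext => n; rewrite fpsM.unlock (reindex_inj rev_ord_inj) /=.
by apply: eq_bigr => -[i /= ilen] _; rewrite subSS subKn // mulrC.
Qed.

HB.instance Definition _ := GRing.PzRing_hasCommutativeMul.Build (fps R) fpsMC.
End FpsComRing.

HB.lock Definition fpsZ (R : nzRingType) (V : lmodType R) (a : fps R) (F : fps V) :
  fps V := fun n => \sum_(i < n.+1) a i *: F (n - i)%N.

Section FpsLmodule.
Variables (R : nzRingType) (V : lmodType R).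
Implicit Types (a b : fps R) (F G : fps V).
Local Notation fpsZ := (@fpsZ R V).

Fact fpsZA a b F : fpsZ a (fpsZ b F) = fpsZ (a * b) F.
Proof.
apply/funext => n; rewrite fpsZ.unlock.
under eq_bigr do rewrite scaler_sumr.
under [RHS]eq_bigr do rewrite fpsME scaler_suml.
rewrite (sum_triangle (fun i j => a i *: (b j *: F (n - i - j)%N))).
apply: eq_bigr => j _; apply: eq_bigr => -[i /= ilej] _.
by rewrite -subnDA subnKC // scalerA.
Qed.

Fact fps1Z : left_id 1 fpsZ.
Proof.
move=> F; apply/funext => n; rewrite fpsZ.unlock big_ord_recl /= scale1r subn0.
by rewrite big1 ?addr0 // => i _; rewrite scale0r.
Qed.

Fact fpsZDr : right_distributive fpsZ +%R.
Proof.
move=> a F G; apply/funext => n; rewrite fpsDE fpsZ.unlock -big_split /=.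
by apply: eq_bigr => i _; rewrite scalerDr.
Qed.

Fact fpsZDl F : {morph fpsZ^~ F : a b / a + b}.
Proof.
move=> a b; apply/funext => n; rewrite fpsDE fpsZ.unlock -big_split /=.
by apply: eq_bigr => i _; rewrite scalerDl.
Qed.

HB.instance Definition _ := GRing.Zmodule_isLmodule.Build (fps R) (fps V)
  fpsZA fps1Z fpsZDr fpsZDl.

Lemma fpsZE a F n : (a *: F) n = \sum_(i < n.+1) a i *: F (n - i)%N.
Proof. by rewrite -[LHS]/(fpsZ a F n) fpsZ.unlock. Qed.
End FpsLmodule.

Section FpsLalgebra.
Variables (R : nzRingType) (A : lalgType R).

Fact fpsZAl (a : fps R) (F G : fps A) : a *: (F * G) = a *: F * G.
Proof.
apply/funext => n; rewrite fpsZE fpsME.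
under eq_bigr do rewrite fpsME scaler_sumr.
under [RHS]eq_bigr do rewrite fpsZE mulr_suml.
rewrite (sum_triangle (fun i j => a i *: (F j * G (n - i - j)%N))).
apply: eq_bigr => j _; apply: eq_bigr => -[i /= ilej] _.
by rewrite -subnDA subnKC // scalerAl.
Qed.

HB.instance Definition _ := GRing.Lmodule_isLalgebra.Build (fps R) (fps A) fpsZAl.
End FpsLalgebra.

Section FpsAlgebra.
Variables (R : comNzRingType) (A : algType R).

Fact fpsZAr (a : fps R) (F G : fps A) : a *: (F * G) = F * (a *: G).
Proof.
apply/funext => n; rewrite fpsZE fpsME.
under eq_bigr do rewrite fpsME scaler_sumr.
under [RHS]eq_bigr do rewrite fpsZE mulr_sumr.
rewrite (sum_triangle (fun i j => a i *: (F j * G (n - i - j)%N))).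
rewrite (sum_triangle (fun i j => F i * (a j *: G (n - i - j)%N))).
apply: eq_bigr => j _; rewrite (reindex_inj rev_ord_inj).
apply: eq_bigr => -[i /= ilej] _; rewrite subSS -scalerAr subKn //.
by rewrite -!subnDA subnK // subnKC.
Qed.

HB.instance Definition _ := GRing.Lalgebra_isAlgebra.Build (fps R) (fps A) fpsZAr.
End FpsAlgebra.

Lemma fps_hbarZ (R : nzRingType) (V : lmodType R) (F : fps V) n :
  ((hbar : fps R) *: F) n = if n is m.+1 then F m else 0.
Proof.
rewrite fpsZE; case: n => [|n]; first by rewrite big_ord1 scale0r.
rewrite big_ord_recl /= scale0r add0r big_ord_recl /= scale1r subn1 /=.
by rewrite big1 ?addr0 // => i _; rewrite /hbar scale0r.
Qed.

Section QuotientVector.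
Variables (K : fieldType) (V : vectType K) (U : {vspace V}).

(* V / U with the K-vector space structure making \pi linear. *)
Definition quotv : Type := Quotient.quot U.
HB.instance Definition _ := EqQuotient.on quotv.
HB.instance Definition _ := GRing.Zmodule.on quotv.

Lemma quotv_eq (x y : V) : (\pi_quotv x == \pi_quotv y) = (x - y \in U).
Proof. exact: (esym (Quotient.idealrBE U x y)). Qed.

Lemma quotv_piD (x y : V) : \pi_quotv (x + y) = \pi_quotv x + \pi_quotv y.
Proof. by rewrite !piE. Qed.

Definition quotv_scale (a : K) (q : quotv) : quotv := \pi_quotv (a *: repr q).

Lemma quotv_piZ a (x : V) : \pi_quotv (a *: x) = quotv_scale a (\pi_quotv x).
Proof.
apply/eqP; rewrite quotv_eq -scalerBr memvZ // -quotv_eq.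
by rewrite reprK.
Qed.

Fact quotv_scaleA a b q : quotv_scale a (quotv_scale b q) = quotv_scale (a * b) q.
Proof. by rewrite -[q]reprK -!quotv_piZ scalerA ?reprK. Qed.
Fact quotv_scale1 : left_id 1 quotv_scale.
Proof. by move=> q; rewrite -[q]reprK -!quotv_piZ scale1r. Qed.
Fact quotv_scaleDr : right_distributive quotv_scale +%R.
Proof.
move=> a p q; rewrite -[p]reprK -[q]reprK -quotv_piD -!quotv_piZ -quotv_piD.
by rewrite scalerDr.
Qed.
Fact quotv_scaleDl q : {morph quotv_scale^~ q : a b / a + b}.
Proof. by move=> a b; rewrite -[q]reprK -!quotv_piZ -quotv_piD scalerDl. Qed.

HB.instance Definition _ := GRing.Zmodule_isLmodule.Build K quotv
  quotv_scaleA quotv_scale1 quotv_scaleDr quotv_scaleDl.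

Fact quotv_pi_linear : linear (\pi_quotv : V -> quotv).
Proof. by move=> a x y; rewrite quotv_piD quotv_piZ. Qed.

(* A complement of U provides coordinates on V / U. *)
Let W := (U^C)%VS.
Let v2r (q : quotv) : 'rV[K]_(\dim W) :=
  \row_i coord (vbasis W) i (daddv_pi W U (repr q)).
Let r2v (r : 'rV[K]_(\dim W)) : quotv := \pi_quotv (\sum_i r 0 i *: (vbasis W)`_i).

Fact quotv_vect_axiom : Vector.axiom (\dim W) quotv.
Proof.
have WU0 : (W :&: U = 0)%VS by rewrite capvC capv_compl.
have UW0 : (U :&: W = 0)%VS by rewrite capv_compl.
have WUT : (W + U = fullv)%VS by rewrite addvC addv_complf.
have v2r_pi x : v2r (\pi_quotv x) = \row_i coord (vbasis W) i (daddv_pi W U x).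
  apply/rowP => i; rewrite !mxE; congr (coord _ _ _).
  apply/eqP; rewrite -subr_eq0 -linearB /=; apply/eqP.
  have : repr (\pi_quotv x) - x \in U by rewrite -quotv_eq reprK.
  set u := _ - _ => uU.
  have := daddv_pi_add WU0 (_ : u \in W + U)%VS; rewrite WUT memvf => /(_ isT).
  rewrite (daddv_pi_id UW0 uU) => /(canRL (addrK _)).
  by rewrite subrr.
exists v2r.
  move=> a p q; rewrite -[p]reprK -[q]reprK -quotv_pi_linear !v2r_pi.
  by apply/rowP => i; rewrite !mxE !linearP.
exists r2v => [q|r].
  rewrite -[q]reprK v2r_pi /r2v; apply/eqP; rewrite quotv_eq.
  under eq_bigr do rewrite mxE.
  set x := repr q; rewrite -(coord_vbasis (memv_pi W U x)).
  have {2}<- := daddv_pi_add WU0 (_ : x \in W + U)%VS; last by rewrite WUT memvf.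
  by rewrite opprD addNKr memvN memv_pi.
rewrite /r2v v2r_pi; apply/rowP => i; rewrite mxE daddv_pi_id //.
  by rewrite coord_sum_free // (basis_free (vbasisP W)).
by apply: memv_suml => j _; rewrite memvZ // vbasis_mem // mem_nth ?size_tuple.
Qed.
HB.instance Definition _ := Lmodule_hasFinDim.Build K quotv quotv_vect_axiom.
End QuotientVector.

HB.mixin Record Vector_isLoday (K : fieldType) L of Vector K L := {
  lbr : L -> L -> L;
  lbr_linearl : forall y, linear (lbr^~ y);
  lbr_linearr : forall x, linear (lbr x);
  lbr_leibniz : forall x y z, lbr x (lbr y z) = lbr (lbr x y) z + lbr y (lbr x z)
}.

#[short(type="finLodayType")]
HB.structure Definition FinLoday (K : fieldType) :=
  {L of Vector_isLoday K L & Vector K L}.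

HB.instance Definition _ (K : fieldType) (L : finLodayType K) (x : L) :=
  GRing.isLinear.Build K L L *:%R (lbr x) (lbr_linearr x).

Section LieQuotient.
Variables (K : fieldType) (L : finLodayType K).
Implicit Types x y z : L.

Lemma lbrDl x y z : lbr (x + y) z = lbr x z + lbr y z.
Proof. by have := lbr_linearl z 1 x y; rewrite /= !scale1r. Qed.
Lemma lbr0l z : lbr 0 z = 0.
Proof. by apply: (addIr (lbr 0 z)); rewrite -lbrDl !add0r. Qed.
Lemma lbrZl a x z : lbr (a *: x) z = a *: lbr x z.
Proof. by have := lbr_linearl z a x 0; rewrite /= lbr0l !addr0. Qed.
Lemma lbr_suml (I : Type) (r : seq I) (F : I -> L) z :
  lbr (\sum_(i <- r) F i) z = \sum_(i <- r) lbr (F i) z.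
Proof.
elim/big_rec2: _ => [|i u v _ <-]; [exact: lbr0l | exact: lbrDl].
Qed.
Lemma lbrBl x y z : lbr (x - y) z = lbr x z - lbr y z.
Proof. by rewrite lbrDl -scaleN1r lbrZl scaleN1r. Qed.

Definition symbr x y : L := lbr x y + lbr y x.

Definition gann_gens : seq L :=
  [seq symbr x y | x <- vbasis {:L}, y <- vbasis {:L}].

(* By bilinearity the symbr of basis vectors span all of them: symbr_gann. *)
Definition gann : {vspace L} := <<gann_gens>>%VS.

Lemma symbr_gann x y : symbr x y \in gann.
Proof.
have memb i j : symbr (vbasis {:L})`_i (vbasis {:L})`_j \in gann.
  have [ii|/(nth_default 0)->] := ltnP i (size (vbasis {:L})); last first.
    by rewrite /symbr lbr0l linear0 addr0 mem0v.
  have [jj|/(nth_default 0)->] := ltnP j (size (vbasis {:L})); last first.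
    by rewrite /symbr lbr0l linear0 addr0 mem0v.
  by apply/memv_span/allpairsP; exists ((vbasis {:L})`_i, (vbasis {:L})`_j);
    rewrite !mem_nth.
rewrite (coord_vbasis (memvf x)) (coord_vbasis (memvf y)) /symbr.
rewrite !lbr_suml; under eq_bigr do rewrite lbrZl linear_sum.
under [X in _ + X]eq_bigr do rewrite lbrZl linear_sum.
under [X in _ + X]eq_bigr do rewrite scaler_sumr.
rewrite [X in _ + X]exchange_big -big_split /=.
apply: memv_suml => i _; rewrite scaler_sumr -big_split; apply: memv_suml => j _ /=.
rewrite !linearZ /= !scalerA [_ * coord _ i x]mulrC -scalerDr.
exact/memvZ/memb.
Qed.

Lemma gann_sub (U : {vspace L}) :
  reflect (forall x y, symbr x y \in U) (gann <= U)%VS.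
Proof.
apply: (iffP idP) => [sU x y|sU]; first exact: (subvP sU) (symbr_gann x y).
by apply/span_subvP => _ /allpairsP[[x y] [_ _ ->]].
Qed.

Lemma lbr_symbr x y z : lbr (symbr x y) z = 0.
Proof.
rewrite /symbr lbrDl; apply: (addIr (lbr y (lbr x z))).
by rewrite addrAC -lbr_leibniz addrC -lbr_leibniz add0r.
Qed.

Lemma lbr_annl u z : u \in gann -> lbr u z = 0.
Proof.
rewrite -[gann]/(<<in_tuple gann_gens>>%VS).
move=> /coord_span ->; rewrite lbr_suml big1 // => i _.
rewrite lbrZl /=.
have /allpairsP[[x y] [_ _ ->]] : gann_gens`_i \in gann_gens by rewrite mem_nth.
by rewrite lbr_symbr scaler0.
Qed.

Lemma lbr_annr x u : u \in gann -> lbr x u \in gann.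
Proof.
move=> uann; have := symbr_gann x u.
by rewrite /symbr (lbr_annl _ uann) addr0.
Qed.

Definition gLie : Type := quotv gann.
HB.instance Definition _ := EqQuotient.on gLie.
HB.instance Definition _ := Vector.on gLie.

Definition bar x : gLie := \pi_gLie x.

Lemma bar_linear : linear bar.
Proof. exact: quotv_pi_linear. Qed.
HB.instance Definition _ := GRing.isLinear.Build K L gLie *:%R bar bar_linear.

Definition lieb (u v : gLie) : gLie := bar (lbr (repr u) (repr v)).

Lemma bar_eq x y : (bar x == bar y) = (x - y \in gann).
Proof. exact: quotv_eq. Qed.

Lemma bar_repr (u : gLie) : bar (repr u) = u.
Proof. exact: reprK. Qed.

Lemma repr_bar x : repr (bar x) - x \in gann.
Proof. by rewrite -bar_eq bar_repr. Qed.

Lemma lbr_bar x x' y : bar x = bar x' -> lbr x y = lbr x' y.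
Proof.
move/eqP; rewrite bar_eq => annx; apply/eqP.
by rewrite -subr_eq0 -lbrBl lbr_annl.
Qed.

Lemma lbr_repr_bar x y : lbr (repr (bar x)) y = lbr x y.
Proof. exact: lbr_bar (bar_repr _). Qed.

Lemma lieb_bar x y : lieb (bar x) (bar y) = bar (lbr x y).
Proof.
apply/eqP; rewrite bar_eq lbr_repr_bar -linearB /=.
by rewrite lbr_annr ?repr_bar.
Qed.

Lemma lieb_linearr u : linear (lieb u).
Proof.
move=> a v w; rewrite -(bar_repr u) -(bar_repr v) -(bar_repr w).
by rewrite -linearP !lieb_bar linearP linearP.
Qed.

HB.instance Definition _ (u : gLie) :=
  GRing.isLinear.Build K gLie gLie *:%R (lieb u) (lieb_linearr u).

Lemma liebC (u v : gLie) : lieb u v = - lieb v u.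
Proof.
apply/eqP; rewrite -(bar_repr u) -(bar_repr v) !lieb_bar -linearN bar_eq opprK.
exact: symbr_gann.
Qed.

Lemma lieb_jacobi (u v w : gLie) :
  lieb u (lieb v w) = lieb (lieb u v) w + lieb v (lieb u w).
Proof.
rewrite -(bar_repr u) -(bar_repr v) -(bar_repr w) !lieb_bar lbr_leibniz.
by rewrite linearD.
Qed.

End LieQuotient.

Notation tensor V L := {ffun 'I_(\dim {:L}) -> V}.

Section TensorProduct.
Variables (K : fieldType) (L : vectType K).

(* The pure tensor v \otimes x, for V a K-vector space and for V a K[[hbar]]-module. *)
Definition tens (V : lmodType K) (v : V) (x : L) : tensor V L :=
  [ffun i => coord (vbasis {:L}) i x *: v].

Definition htens (V : lmodType (fps K)) (v : V) (x : L) : tensor V L :=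
  [ffun i => (fpsC (coord (vbasis {:L}) i x) : fps K) *: v].

Definition tens_map (V W : Type) (I : V -> W) (a : tensor V L) : tensor W L :=
  [ffun i => I (a i)].

Lemma tens_linearr (V : lmodType K) (v : V) : linear (tens v).
Proof. by move=> a x y; apply/ffunP => i; rewrite !ffunE linearP scalerDl scalerA. Qed.
HB.instance Definition _ (V : lmodType K) (v : V) :=
  GRing.isLinear.Build K L (tensor V L) *:%R (tens v) (tens_linearr v).

Lemma tensDl (V : lmodType K) (u v : V) x : tens (u + v) x = tens u x + tens v x.
Proof. by apply/ffunP => i; rewrite !ffunE scalerDr. Qed.
Lemma tensZl (V : lmodType K) a (v : V) x : tens (a *: v) x = a *: tens v x.
Proof. by apply/ffunP => i; rewrite !ffunE !scalerA mulrC. Qed.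
End TensorProduct.

Section LodayPoisson.
Variables (K : fieldType) (L : finLodayType K).

Definition nLie : nat := \dim {: gLie L}.

(* The symmetric algebra of gLie L, as polynomials on a basis of gLie L. *)
Definition Sym : Type := mpoly nLie K.
HB.instance Definition _ := GRing.ComAlgebra.on Sym.

Implicit Types (f g h : Sym) (x y : L) (u v : gLie L) (a b : tensor Sym L).

Definition symv u : Sym := \sum_(i < nLie) coord (vbasis {: gLie L}) i u *: 'X_i.

Lemma symv_linear : linear symv.
Proof.
move=> c u v; rewrite scaler_sumr -big_split; apply: eq_bigr => i _ /=.
by rewrite linearP scalerDl scalerA.
Qed.
HB.instance Definition _ := GRing.isLinear.Build K (gLie L) Sym *:%R symv symv_linear.

Definition poisson f g : Sym :=
  \sum_(i < nLie) \sum_(j < nLie)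
    f^`M(i) * g^`M(j) * symv (lieb (vbasis {: gLie L})`_i (vbasis {: gLie L})`_j).

(* {f, y} : f is derived in the direction of each basis vector of gLie L, which
   then acts on y. *)
Definition lp_act f y : tensor Sym L :=
  \sum_(i < nLie) tens f^`M(i) (lbr (repr (vbasis {: gLie L})`_i) y).

Definition lp_scale g a : tensor Sym L := [ffun i => g * a i].

(* f \otimes x |-> f * bar x *)
Definition lp_contract a : Sym :=
  \sum_(i < \dim {:L}) a i * symv (bar (vbasis {:L})`_i).

Definition lp_mul a b : tensor Sym L := lp_scale (lp_contract a) b.

Definition lp_ham f b : tensor Sym L :=
  [ffun j => poisson f (b j)]
  + \sum_(j < \dim {:L}) lp_scale (b j) (lp_act f (vbasis {:L})`_j).

Definition lp_bracket a b : tensor Sym L := lp_ham (lp_contract a) b.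

Lemma lp_contractE f x : lp_contract (tens f x) = f * symv (bar x).
Proof.
rewrite {2}(coord_vbasis (memvf x)) !linear_sum mulr_sumr.
by apply: eq_bigr => i _; rewrite ffunE !linearZ /= -scalerAl -scalerAr.
Qed.

Lemma lp_scaleE g h y : lp_scale g (tens h y) = tens (g * h) y.
Proof. by apply/ffunP => i; rewrite !ffunE scalerAr. Qed.

Lemma lp_mulE f x g y :
  lp_mul (tens f x) (tens g y) = tens (f * symv (bar x) * g) y.
Proof. by rewrite /lp_mul lp_contractE lp_scaleE. Qed.

Lemma poissonZr f c g : poisson f (c *: g) = c *: poisson f g.
Proof.
rewrite /poisson scaler_sumr; apply: eq_bigr => i _; rewrite scaler_sumr.
by apply: eq_bigr => j _; rewrite linearZ /= -scalerAr -scalerAl.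
Qed.

Lemma lp_actDr f y z : lp_act f (y + z) = lp_act f y + lp_act f z.
Proof.
by rewrite -big_split; apply: eq_bigr => i _; rewrite /= !linearD.
Qed.
Lemma lp_actZr f c y : lp_act f (c *: y) = c *: lp_act f y.
Proof. by rewrite scaler_sumr; apply: eq_bigr => i _; rewrite !linearZ. Qed.
Lemma lp_act_linear f : linear (lp_act f).
Proof. by move=> c y z; rewrite lp_actDr lp_actZr. Qed.
HB.instance Definition _ f :=
  GRing.isLinear.Build K L (tensor Sym L) *:%R (lp_act f) (lp_act_linear f).

Lemma lp_hamE f g y :
  lp_ham f (tens g y) = tens (poisson f g) y + lp_scale g (lp_act f y).
Proof.
congr (_ + _); first by apply/ffunP => j; rewrite !ffunE poissonZr.
rewrite {2}(coord_vbasis (memvf y)) linear_sum; apply/ffunP => i.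
rewrite sum_ffunE !ffunE sum_ffunE mulr_sumr; apply: eq_bigr => j _.
by rewrite linearZ !ffunE -scalerAl scalerAr.
Qed.

Lemma lp_bracketE f x g y :
  lp_bracket (tens f x) (tens g y) = lp_ham (f * symv (bar x)) (tens g y).
Proof. by rewrite /lp_bracket lp_contractE. Qed.

Lemma mderiv_symv u i : (symv u)^`M(i) = (coord (vbasis {: gLie L}) i u)%:MP.
Proof.
rewrite /symv linear_sum (bigD1 i) //= linearZ /= mderivX mnmE eqxx.
rewrite big1 => [|j ji]; last first.
  by rewrite linearZ /= mderivX mnmE (negPf ji) scale0r scaler0.
rewrite addr0 scale1r -mul_mpolyC.
have -> : (U_(i) - U_(i))%MM = 0%MM :> 'X_{1..nLie}
  by apply/mnmP => k; rewrite mnmBE subnn mnm0E.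
by rewrite mpolyX0 mulr1.
Qed.

Lemma poisson_symv u v : poisson (symv u) (symv v) = symv (lieb u v).
Proof.
have liebl w : lieb u w
    = \sum_(i < nLie) coord (vbasis {: gLie L}) i u *: lieb (vbasis {: gLie L})`_i w.
  rewrite liebC {1}(coord_vbasis (memvf u)) (linear_sum (lieb w)) -sumrN.
  by apply: eq_bigr => i _; rewrite /= [lieb w (_ *: _)]linearZ /= -scalerN -liebC.
rewrite liebl (linear_sum symv); apply: eq_bigr => i _; rewrite [RHS]linearZ /=.
rewrite {2}(coord_vbasis (memvf v)) (linear_sum (lieb _)) (linear_sum symv) scaler_sumr.
apply: eq_bigr => j _; rewrite /= [lieb _ (_ *: _)]linearZ [symv (_ *: _)]linearZ /= !mderiv_symv.
by rewrite -mulrA !mul_mpolyC.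
Qed.

Lemma poissonC f g : poisson f g = - poisson g f.
Proof.
rewrite /poisson exchange_big -sumrN; apply: eq_bigr => i _ /=.
rewrite -sumrN; apply: eq_bigr => j _.
by rewrite liebC linearN /= mulrN [_ * f^`M(_)]mulrC.
Qed.

Lemma poissonMr f g h : poisson f (g * h) = poisson f g * h + g * poisson f h.
Proof.
rewrite /poisson mulr_suml mulr_sumr -big_split; apply: eq_bigr => i _ /=.
rewrite mulr_suml mulr_sumr -big_split; apply: eq_bigr => j _ /=.
rewrite mderivM; ring.
Qed.

(* The formula for {_, y} on an arbitrary monomial of S(gLie L). *)
Lemma lp_act_prod m (xs : 'I_m -> L) y :
  lp_act (\prod_(k < m) symv (bar (xs k))) y
    = \sum_(k < m) tens (\prod_(l < m | l != k) symv (bar (xs l))) (lbr (xs k) y).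
Proof.
have mderiv_prod p (F : 'I_p -> Sym) i :
    (\prod_(k < p) F k)^`M(i)
      = \sum_(k < p) (F k)^`M(i) * \prod_(l < p | l != k) F l.
  elim: p F => [|p IH] F; first by rewrite !big_ord0 -mpolyC1 mderivC.
  rewrite !big_ord_recl mderivM IH mulr_sumr; congr (_ * _ + _).
    by rewrite [RHS]big_mkcond big_ord_recl /= mul1r.
  apply: eq_bigr => k _; rewrite [in RHS]big_mkcond big_ord_recl /=.
  rewrite mulrCA; congr (_ * (_ * _)); rewrite [LHS]big_mkcond.
  by apply: eq_bigr => l _; rewrite (inj_eq lift_inj).
rewrite /lp_act.
under eq_bigr do rewrite mderiv_prod.
transitivity (\sum_(k < m) \sum_(i < nLie)
  tens ((symv (bar (xs k)))^`M(i) * \prod_(l < m | l != k) symv (bar (xs l)))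
       (lbr (repr (vbasis {: gLie L})`_i) y)).
  rewrite exchange_big; apply: eq_bigr => i _ /=.
  by apply/ffunP => j; rewrite sum_ffunE !ffunE scaler_sumr;
    apply: eq_bigr => k _; rewrite ffunE.
apply: eq_bigr => k _.
under eq_bigr do rewrite mderiv_symv mul_mpolyC tensZl -linearZ -lbrZl.
rewrite -linear_sum -lbr_suml; congr tens; apply: lbr_bar.
rewrite linear_sum [RHS](coord_vbasis (memvf _)); apply: eq_bigr => i _.
by rewrite linearZ /= bar_repr.
Qed.
End LodayPoisson.

Section EnvelopingAlgebra.
Variables (K : fieldType) (L : finLodayType K).

(* The tensor algebra of gLie L, as the free algebra on a basis of gLie L. *)
Definition tensorAlg : lalgType K := {malg K[{fmonom 'I_(nLie L)}]}.

Definition tensorv (u : gLie L) : tensorAlg :=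
  \sum_(i < nLie L) coord (vbasis {: gLie L}) i u *: << fmu i >>.

Definition Uh_relator (u v : gLie L) : fps tensorAlg :=
  fpsC (tensorv u) * fpsC (tensorv v) - fpsC (tensorv v) * fpsC (tensorv u)
  - (hbar : fps K) *: fpsC (tensorv (lieb u v)).

Inductive Uh_ideal : fps tensorAlg -> Prop :=
| Uh_ideal0 : Uh_ideal 0
| Uh_idealD F u v G H :
    Uh_ideal H -> Uh_ideal (F * Uh_relator u v * G + H).

(* Dividing by the hbar-adic closure of the ideal yields the completed algebra. *)
Definition Uh_closed_ideal : {pred fps tensorAlg} := fun F =>
  `[< forall m, exists2 G, Uh_ideal G & forall n, (n < m)%N -> F n = G n >].

Lemma Uh_ideal_add F G : Uh_ideal F -> Uh_ideal G -> Uh_ideal (F + G).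
Proof.
move=> IF IG; elim: IF => [|A u v B H _ IH]; first by rewrite add0r.
by rewrite -addrA; apply: Uh_idealD.
Qed.

Lemma Uh_idealN F : Uh_ideal F -> Uh_ideal (- F).
Proof.
elim=> [|A u v B H _ IH]; first by rewrite oppr0; exact: Uh_ideal0.
by rewrite opprD -!mulNr; apply: Uh_idealD.
Qed.

Lemma Uh_idealM A F B : Uh_ideal F -> Uh_ideal (A * F * B).
Proof.
have distr (R : nzRingType) (a b c d e f : R) :
  a * (b * c * d + e) * f = (a * b) * c * (d * f) + a * e * f.
  by rewrite mulrDr mulrDl !mulrA.
elim=> [|C u v D H _ IH]; first by rewrite mulr0 mul0r; exact: Uh_ideal0.
by rewrite distr; exact: Uh_idealD.
Qed.

Fact Uh_closed_ideal_zmod_closed : zmod_closed Uh_closed_ideal.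
Proof.
split; first by apply/asboolP => m; exists 0 => //; exact: Uh_ideal0.
move=> F G /asboolP IF /asboolP IG; apply/asboolP => m.
have [[F' IF' eF] [G' IG' eG]] := (IF m, IG m).
exists (F' - G') => [|n nm]; first exact: Uh_ideal_add IF' (Uh_idealN IG').
by rewrite !fpsDE !fpsNE eF ?eG.
Qed.
HB.instance Definition _ :=
  GRing.isZmodClosed.Build (fps tensorAlg) Uh_closed_ideal Uh_closed_ideal_zmod_closed.

Lemma Uh_closed_idealM A F B :
  F \in Uh_closed_ideal -> A * F * B \in Uh_closed_ideal.
Proof.
move=> /asboolP IF; apply/asboolP => m; have [F' IF' eF] := IF m.
exists (A * F' * B) => [|n nm]; first exact: Uh_idealM.
rewrite [LHS]fpsME [RHS]fpsME; apply: eq_bigr => -[i /= lein] _; congr (_ * _).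
rewrite [LHS]fpsME [RHS]fpsME; apply: eq_bigr => -[j /= leji] _; congr (_ * _).
by apply: eF; apply: leq_ltn_trans nm; rewrite (leq_trans (leq_subr _ _)).
Qed.

Lemma Uh_closed_ideal1 : 1 \notin Uh_closed_ideal.
Proof.
pose aug : {rmorphism tensorAlg -> K} :=
  (@monalg.mcoeff {fmonom 'I_(nLie L)} K monalg.mone
     : {rmorphism {malg K[{fmonom 'I_(nLie L)}]} -> K}).
have augD (A : lalgType K) (f : {rmorphism A -> K}) (x y z : A) (F G H : fps A) :
    f ((F * (fpsC x * fpsC y - fpsC y * fpsC x - (hbar : fps K) *: fpsC z) * G + H)
         0%N) = f (H 0%N).
  rewrite fpsDE rmorphD !fps0M !rmorphM !fpsDE !fpsNE !fps0M fps_hbarZ subr0.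
  by rewrite rmorphB !rmorphM [X in X - _]mulrC subrr mulr0 mul0r add0r.
apply/negP => /asboolP /(_ 1%N) [F IF /(_ 0%N isT)] F1.
have aug0 : aug (F 0%N) = 0.
  by elim: IF {F1} => [|A u v B H _ IH]; rewrite ?fps0E ?rmorph0 // augD.
by have /eqP := oner_neq0 K; rewrite -aug0 -F1 /= rmorph1.
Qed.

(* The completed enveloping algebra of (gLie L)[[hbar]] with bracket hbar * lieb *)
Definition Uh : Type := Quotient.quot Uh_closed_ideal.
HB.instance Definition _ := EqQuotient.on Uh.
HB.instance Definition _ := GRing.Zmodule.on Uh.

Lemma Uh_eq (F G : fps tensorAlg) :
  (\pi_Uh F == \pi_Uh G) = (F - G \in Uh_closed_ideal).
Proof. exact: (esym (Quotient.idealrBE Uh_closed_ideal F G)). Qed.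

Lemma Uh_piD (F G : fps tensorAlg) : \pi_Uh (F + G) = \pi_Uh F + \pi_Uh G.
Proof. by rewrite !piE. Qed.

Definition Uh1 : Uh := \pi_Uh 1.
Definition UhM (a b : Uh) : Uh := \pi_Uh (repr a * repr b).
Definition UhZ (c : fps K) (a : Uh) : Uh := \pi_Uh (c *: repr a).

Lemma Uh_piM (F G : fps tensorAlg) : \pi_Uh (F * G) = UhM (\pi_Uh F) (\pi_Uh G).
Proof.
set F' := repr (\pi_Uh F); set G' := repr (\pi_Uh G); apply/eqP; rewrite Uh_eq.
have IF : F - F' \in Uh_closed_ideal by rewrite -Uh_eq reprK.
have IG : G - G' \in Uh_closed_ideal by rewrite -Uh_eq reprK.
have -> : F * G - F' * G' = 1 * (F - F') * G + F' * (G - G') * 1.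
  by rewrite mul1r mulr1 mulrBl mulrBr addrA subrK.
by rewrite rpredD // Uh_closed_idealM.
Qed.

Lemma Uh_piZ (c : fps K) (F : fps tensorAlg) : \pi_Uh (c *: F) = UhZ c (\pi_Uh F).
Proof.
apply/eqP; rewrite Uh_eq -scalerBr -[X in _ *: X]mul1r scalerAl -[_ * _]mulr1.
by rewrite Uh_closed_idealM // -Uh_eq reprK.
Qed.

Fact UhMA : associative UhM.
Proof.
move=> a b c; rewrite -[a]reprK -[b]reprK -[c]reprK.
by rewrite -(Uh_piM (repr b)) -(Uh_piM (repr a) (repr b)) -2!Uh_piM mulrA.
Qed.
Fact Uh1M : left_id Uh1 UhM.
Proof. by move=> a; rewrite -[a]reprK -Uh_piM mul1r. Qed.
Fact UhM1 : right_id Uh1 UhM.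
Proof. by move=> a; rewrite -[a]reprK -Uh_piM mulr1. Qed.
Fact UhMDl : left_distributive UhM +%R.
Proof.
move=> a b c; rewrite -[a]reprK -[b]reprK -[c]reprK.
by rewrite -Uh_piD -!Uh_piM -Uh_piD mulrDl.
Qed.
Fact UhMDr : right_distributive UhM +%R.
Proof.
move=> a b c; rewrite -[a]reprK -[b]reprK -[c]reprK.
by rewrite -Uh_piD -!Uh_piM -Uh_piD mulrDr.
Qed.
Fact Uh1_neq0 : Uh1 != 0.
Proof.
have -> : 0 = \pi_Uh 0 :> Uh by rewrite !piE.
by rewrite Uh_eq subr0 Uh_closed_ideal1.
Qed.
HB.instance Definition _ := GRing.Zmodule_isNzRing.Build Uh
  UhMA Uh1M UhM1 UhMDl UhMDr Uh1_neq0.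

Fact UhZA b c (a : Uh) : UhZ b (UhZ c a) = UhZ (b * c) a.
Proof.
by rewrite -[a]reprK -(Uh_piZ c (repr a)) -(Uh_piZ (b * c)) -Uh_piZ scalerA.
Qed.
Fact Uh1Z : left_id 1 UhZ.
Proof. by move=> a; rewrite -[a]reprK -Uh_piZ scale1r. Qed.
Fact UhZDr : right_distributive UhZ +%R.
Proof.
move=> c a b; rewrite -[a]reprK -[b]reprK.
by rewrite -Uh_piD -!Uh_piZ -Uh_piD scalerDr.
Qed.
Fact UhZDl a : {morph UhZ^~ a : b c / b + c}.
Proof. by move=> b c; rewrite -[a]reprK -!Uh_piZ -Uh_piD scalerDl. Qed.
HB.instance Definition _ := GRing.Zmodule_isLmodule.Build (fps K) Uh
  UhZA Uh1Z UhZDr UhZDl.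

Fact UhZAl c (a b : Uh) : c *: (a * b) = c *: a * b.
Proof.
rewrite -[a]reprK -[b]reprK -[_ * _]Uh_piM -[LHS]Uh_piZ.
by rewrite -[_ *: \pi_Uh _]Uh_piZ -[RHS]Uh_piM scalerAl.
Qed.
HB.instance Definition _ := GRing.Lmodule_isLalgebra.Build (fps K) Uh UhZAl.

Definition Uh_gen (u : gLie L) : Uh := \pi_Uh (fpsC (tensorv u)).

Lemma Uh_genC u v :
  Uh_gen u * Uh_gen v - Uh_gen v * Uh_gen u = (hbar : fps K) *: Uh_gen (lieb u v).
Proof.
rewrite -[_ * _]Uh_piM -[X in _ - X]Uh_piM -[RHS]Uh_piZ.
apply/eqP; rewrite subr_eq -Uh_piD Uh_eq opprD addrA addrAC.
rewrite -[X in X \in _]/(Uh_relator u v); apply/asboolP => m.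
exists (1 * Uh_relator u v * 1 + 0) => [|n _]; last by rewrite addr0 mul1r mulr1.
exact: Uh_idealD Uh_ideal0.
Qed.
End EnvelopingAlgebra.

Section StarDialgebra.
Variables (K : fieldType) (L : finLodayType K).

(* The multiplications of Ud_hbar, given by their defining formulas; since they
   are K[[hbar]]-bilinear, hence hbar-adically continuous, and Uh L is separated,
   the formulas determine them. *)
Record env_dialgebra := EnvDialgebra {
  ud_vdash : {bilinear tensor (Uh L) L -> tensor (Uh L) L -> tensor (Uh L) L};
  ud_dashv : {bilinear tensor (Uh L) L -> tensor (Uh L) L -> tensor (Uh L) L};
  ud_vdashE : forall (F G : Uh L) (x y : L),
    ud_vdash (htens F x) (htens G y) = htens (F * Uh_gen (bar x) * G) y;
  ud_dashv1 : forall (F : Uh L) (x y : L),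
    ud_dashv (htens F x) (htens 1 y)
      = htens (F * Uh_gen (bar y)) x - (hbar : fps K) *: htens F (lbr y x);
  ud_dashv_prod : forall (F : Uh L) (x : L) (ys : seq L) (y : L),
    ud_dashv (htens F x) (htens (\prod_(z <- ys) Uh_gen (bar z)) y)
      = foldl (fun a z => ud_dashv a (htens 1 z)) (htens F x) (rcons ys y)
}.

(* Kontsevich's star product on S(gLie L) enters only through the following
   properties; every product having them is allowed. *)
Record star_product := StarProduct {
  star :> {bilinear fps (Sym L) -> fps (Sym L) -> fps (Sym L)};
  starA : associative star;
  star_coef0 : forall f g : Sym L, star (fpsC f) (fpsC g) 0%N = f * g;
  star_coef1 : forall f g : Sym L,
    star (fpsC f) (fpsC g) 1%N = 2^-1 *: poisson f g;
  star_gen : forall u v : gLie L,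
    star (fpsC (symv u)) (fpsC (symv v))
      = fpsC (symv u * symv v)
        + (hbar : fps K) *: fpsC (2^-1 *: symv (lieb u v))
}.

Record star_iso (st : star_product) := StarIso {
  siso :> {linear Uh L -> fps (Sym L)};
  siso_inv : fps (Sym L) -> Uh L;
  sisoK : cancel siso siso_inv;
  siso_invK : cancel siso_inv siso;
  siso1 : siso 1 = fpsC 1;
  sisoM : forall a b : Uh L, siso (a * b) = st (siso a) (siso b);
  siso_gen : forall u : gLie L, siso (Uh_gen u) = fpsC (symv u)
}.

Section Transport.
Variables (st : star_product) (I : star_iso st) (D : env_dialgebra).
Implicit Types a b : tensor (fps (Sym L)) L.

Definition star_transport
  (op : tensor (Uh L) L -> tensor (Uh L) L -> tensor (Uh L) L) a b :
  tensor (fps (Sym L)) L :=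
  tens_map I (op (tens_map (siso_inv I) a) (tens_map (siso_inv I) b)).

Definition star_vdash := star_transport (ud_vdash D).
Definition star_dashv := star_transport (ud_dashv D).
Definition star_dicomm a b := star_vdash a b - star_dashv b a.
End Transport.

Definition hlim0 (a : tensor (fps (Sym L)) L) : tensor (Sym L) L :=
  tens_map (fun F : fps (Sym L) => F 0%N) a.

End StarDialgebra.

(* Main.v *)
Require Import Defs.
From HB Require Import structures.
From mathcomp Require Import all_boot all_order all_algebra.
From mathcomp Require Import generic_quotient sesquilinear.
From mathcomp Require Import boolp reals complex.
From mathcomp Require Import ring monalg mpoly.

Set Implicit Arguments.
Unset Strict Implicit.
Unset Printing Implicit Defensive.

Import GRing.Theory.
Local Open Scope ring_scope.
Local Open Scope quotient_scope.

(** The classical limit is governed by two facts, in which ox is the tensor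
    product, and |- and -| are the two dialgebra products.

    (1) The product [star_vdash] is the star product in disguise:
    (f ox x) |- (g ox y) = (f * xbar * g) ox y with * the star product, whose
    coefficient of hbar^0 is the commutative product.

    (2) The product [star_dashv] agrees with the same expression up to a
    correction of order hbar, and the leading term of that correction is the
    Hamiltonian action of functions on the Loday algebra:
      (g ox y) -| (f ox x)
        = (g * f * xbar) ox y - hbar g {f xbar, y} + O(hbar^2).
    So with h = f * xbar the dialgebra commutator is
      (h * g - g * h) ox y + hbar g {h, y} + O(hbar^2),
    and since h * g - g * h = hbar {h, g} + O(hbar^2), dividing by hbar leaves
    {h, g} ox y + g {h, y}, the Loday-Poisson bracket.

    Fact (2) is [star_dashvE], which transports along the isomorphism I the same
    statement [dashv_expansionP] about the enveloping dialgebra.  There, if f is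
    a product of generators, multiplication by f ox x on the right iterates
    multiplications by elements 1 ox z, and each step turns F ox y into
    F zbar ox y - hbar F ox [z, y]; to first order in hbar the corrections
    accumulate by the Leibniz rule ([dashv_word], [lp_actMr]), which is what
    {-, y} obeys.  Linearity extends this to the image of the free algebra.
    The completed algebra contains more, but each of its elements is F = A +
    hbar F' with A in that image ([Uh_split_hbar]), and a bootstrap replaces any
    convergence argument: applying -| to hbar F' is trivially an O(hbar)
    correction, so (2) holds modulo hbar for all F; applying that to F' makes
    (2) hold modulo hbar^2 for hbar F', hence for F.

    All of this is read off through the symbol map [symbol], the composite of
    the isomorphism I with hbar = 0: it is a ring morphism onto the
    commutative algebra, so the noncommutative order of the factors disappears
    from the leading terms. *)

(** * Formal power series in hbar *)

Definition fps_shift (V : Type) (F : fps V) : fps V := fun n => F n.+1.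

Lemma fpsC0 (V : zmodType) : fpsC (0 : V) = 0.
Proof. by apply/funext => -[]. Qed.

Lemma fps_split (R : nzRingType) (V : lmodType R) (F : fps V) :
  F = fpsC (F 0%N) + (hbar : fps R) *: fps_shift F.
Proof.
by apply/funext => -[|n]; rewrite fpsDE fps_hbarZ /= ?addr0 ?add0r.
Qed.

Lemma fps_hbarZ0 (R : nzRingType) (V : lmodType R) (F : fps V) :
  F 0%N = 0 -> F = (hbar : fps R) *: fps_shift F.
Proof. by move=> F0; rewrite {1}[F]fps_split F0 fpsC0 add0r. Qed.

Lemma fpsZ0E (R : nzRingType) (V : lmodType R) (c : fps R) (F : fps V) :
  (c *: F) 0%N = c 0%N *: F 0%N.
Proof. by rewrite fpsZE big_ord1. Qed.

Lemma fpsCZE (R : nzRingType) (V : lmodType R) (c : R) (F : fps V) n :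
  ((fpsC c : fps R) *: F) n = c *: F n.
Proof.
rewrite fpsZE big_ord_recl subn0 /= big1 ?addr0 // => i _.
by rewrite scale0r.
Qed.

(** * Tensors over formal power series *)

Section Htens.
Variables (K : fieldType) (L : vectType K).

Lemma htensDl (V : lmodType (fps K)) (u v : V) (x : L) :
  htens (u + v) x = htens u x + htens v x.
Proof. by apply/ffunP => i; rewrite !ffunE scalerDr. Qed.

Lemma htensZl (V : lmodType (fps K)) (c : fps K) (v : V) (x : L) :
  htens (c *: v) x = c *: htens v x.
Proof. by apply/ffunP => i; rewrite !ffunE !scalerA mulrC. Qed.

Lemma htens_basis (V : lmodType (fps K)) (a : tensor V L) :
  a = \sum_i htens (a i) (vbasis {:L})`_i.
Proof.
apply/ffunP => j; rewrite sum_ffunE (bigD1 j) //= ffunE.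
rewrite coord_free ?(basis_free (vbasisP _)) // eqxx.
rewrite [fpsC _]/(1 : fps K) scale1r big1 ?addr0 // => i ij.
rewrite ffunE coord_free ?(basis_free (vbasisP _)) // (negPf ij).
by rewrite fpsC0 scale0r.
Qed.

Lemma tens_map_htens (U V : lmodType (fps K)) (phi : {linear U -> V})
    (u : U) (x : L) :
  tens_map phi (htens u x) = htens (phi u) x.
Proof. by apply/ffunP => i; rewrite !ffunE linearZ. Qed.
End Htens.

(** * First-order expansion of the star product *)

Section Star.
Variables (K : fieldType) (L : finLodayType K).
Variable st : star_product L.
Implicit Types F G : fps (Sym L).

(** The coefficients of a star product are prescribed on constant series only;
    bilinearity over K[[hbar]] peels off the constant terms and pushes the rest
    to order hbar. *)
Lemma star_expand F G : st F G
  = st (fpsC (F 0%N)) (fpsC (G 0%N))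
    + (hbar : fps K) *: (st (fps_shift F) G
                         + st (fpsC (F 0%N)) (fps_shift G)).
Proof.
rewrite {1}(fps_split F) linearDl linearZl_LR.
rewrite {1}(fps_split G) linearDr linearZr_LR.
by rewrite scalerDr addrAC addrA.
Qed.

Lemma star0 F G : st F G 0%N = F 0%N * G 0%N.
Proof. by rewrite star_expand fpsDE fps_hbarZ addr0 star_coef0. Qed.

Lemma star1 F G :
  st F G 1%N = F 1%N * G 0%N + F 0%N * G 1%N + 2^-1 *: poisson (F 0%N) (G 0%N).
Proof.
by rewrite star_expand fpsDE fps_hbarZ fpsDE !star0 star_coef1 addrC.
Qed.

(** The commutative part of order hbar is symmetric and cancels; the two halves
    of the antisymmetric Poisson term add up, which requires 2 to be
    invertible. *)
Lemma star_comm1 F G : 2 != 0 :> K ->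
  (st F G - st G F) 1%N = poisson (F 0%N) (G 0%N).
Proof.
move=> two; rewrite fpsDE fpsNE !star1 (poissonC (G 0%N)) scalerN.
have half p : p = 2^-1 *: p + 2^-1 *: p :> Sym L.
  by rewrite -mulr2n -scaler_nat scalerA mulfV // scale1r.
rewrite [RHS]half; ring.
Qed.
End Star.

(** * The Hamiltonian action on the Loday algebra *)

Section LpAct.
Variables (K : fieldType) (L : finLodayType K).
Implicit Types (f g h : Sym L) (x y : L).

Lemma lp_actDl f g y : lp_act (f + g) y = lp_act f y + lp_act g y.
Proof.
by rewrite -big_split; apply: eq_bigr => i _; rewrite /= mderivD tensDl.
Qed.

Lemma lp_actZl c f y : lp_act (c *: f) y = c *: lp_act f y.
Proof.
by rewrite scaler_sumr; apply: eq_bigr => i _; rewrite mderivZ tensZl.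
Qed.

Lemma lp_act1l y : lp_act (1 : Sym L) y = 0.
Proof.
rewrite /lp_act big1 // => i _; rewrite -mpolyC1 mderivC.
by apply/ffunP => j; rewrite !ffunE scaler0.
Qed.

Lemma lp_scaleDr g (a b : tensor (Sym L) L) :
  lp_scale g (a + b) = lp_scale g a + lp_scale g b.
Proof. by apply/ffunP => i; rewrite !ffunE mulrDr. Qed.

Lemma lp_scaleZr g c (a : tensor (Sym L) L) :
  lp_scale g (c *: a) = c *: lp_scale g a.
Proof. by apply/ffunP => i; rewrite !ffunE scalerAr. Qed.

Lemma lp_scaleA g h (a : tensor (Sym L) L) :
  lp_scale g (lp_scale h a) = lp_scale (g * h) a.
Proof. by apply/ffunP => i; rewrite !ffunE mulrA. Qed.

Lemma lp_scale0 g : lp_scale g (0 : tensor (Sym L) L) = 0.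
Proof. by apply/ffunP => i; rewrite !ffunE mulr0. Qed.

Lemma lp_scale_sum (J : Type) (r : seq J) g (E : J -> tensor (Sym L) L) :
  lp_scale g (\sum_(i <- r) E i) = \sum_(i <- r) lp_scale g (E i).
Proof. exact: (big_morph _ (lp_scaleDr g) (lp_scale0 g)). Qed.

(** The Leibniz rule for {-, y}, which matches the way in which the corrections
    accumulate when a word is lengthened by one letter. *)
Lemma lp_actMr h z y :
  lp_act (h * symv (bar z)) y
    = lp_scale (symv (bar z)) (lp_act h y) + tens h (lbr z y).
Proof.
rewrite /lp_act lp_scale_sum.
under eq_bigr do rewrite mderivM tensDl mderiv_symv mulrC.
rewrite big_split /=; congr (_ + _).
  by apply: eq_bigr => i _; rewrite lp_scaleE.
rewrite -(lbr_repr_bar z) [in RHS](coord_vbasis (memvf (bar z))).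
transitivity (tens h (\sum_(i < nLie L)
    lbr (coord (vbasis {: gLie L}) i (bar z) *: repr (vbasis {: gLie L})`_i) y)).
  rewrite linear_sum; apply: eq_bigr => i _ /=.
  by rewrite mulrC mul_mpolyC tensZl -linearZ -lbrZl.
rewrite -lbr_suml; congr tens; apply: lbr_bar.
rewrite bar_repr linear_sum; apply: eq_bigr => i _.
by rewrite linearZ /= bar_repr.
Qed.
End LpAct.

(** * The right multiplication of the enveloping dialgebra modulo hbar^2 *)

Section Env.
Variables (K : fieldType) (L : finLodayType K).
Variables (st : star_product L) (I : star_iso st) (D : env_dialgebra L).
Implicit Types (F G : Uh L) (x y z : L).

Definition symbol F : Sym L := siso I F 0%N.

Lemma symbolD F G : symbol (F + G) = symbol F + symbol G.
Proof. by rewrite /symbol linearD fpsDE. Qed.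
Lemma symbolZ c F : symbol (c *: F) = c 0%N *: symbol F.
Proof. by rewrite /symbol linearZ /= fpsZ0E. Qed.
Lemma symbolM F G : symbol (F * G) = symbol F * symbol G.
Proof. by rewrite /symbol sisoM star0. Qed.
Lemma symbol1 : symbol 1 = 1.
Proof. by rewrite /symbol siso1. Qed.
Lemma symbol_gen u : symbol (Uh_gen u) = symv u.
Proof. by rewrite /symbol siso_gen. Qed.

Lemma symbol_word (zs : seq L) :
  symbol (\prod_(z <- zs) Uh_gen (bar z)) = \prod_(z <- zs) symv (bar z).
Proof.
elim: zs => [|z zs IH]; first by rewrite !big_nil symbol1.
by rewrite !big_cons symbolM symbol_gen IH.
Qed.

Definition tsymbol (a : tensor (Uh L) L) : tensor (Sym L) L :=
  tens_map symbol a.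

Lemma tsymbolD (a b : tensor (Uh L) L) :
  tsymbol (a + b) = tsymbol a + tsymbol b.
Proof. by apply/ffunP => i; rewrite !ffunE symbolD. Qed.
Lemma tsymbolZ c (a : tensor (Uh L) L) : tsymbol (c *: a) = c 0%N *: tsymbol a.
Proof. by apply/ffunP => i; rewrite !ffunE symbolZ. Qed.
Lemma tsymbol0 : tsymbol 0 = 0.
Proof. by rewrite -(scale0r (0 : tensor (Uh L) L)) tsymbolZ scale0r. Qed.
Lemma tsymbol_sum (J : Type) (r : seq J) (E : J -> tensor (Uh L) L) :
  tsymbol (\sum_(i <- r) E i) = \sum_(i <- r) tsymbol (E i).
Proof. exact: (big_morph _ tsymbolD tsymbol0). Qed.
Lemma tsymbol_htens F x : tsymbol (htens F x) = tens (symbol F) x.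
Proof. by apply/ffunP => i; rewrite !ffunE symbolZ. Qed.

(** The bracket term of a -| (1 ox z) carries a factor hbar, so only
    multiplication by zbar survives at hbar = 0. *)
Lemma tsymbol_dashv1 (a : tensor (Uh L) L) z :
  tsymbol (ud_dashv D a (htens 1 z)) = lp_scale (symv (bar z)) (tsymbol a).
Proof.
rewrite (htens_basis a) linear_sumlz !tsymbol_sum lp_scale_sum.
apply: eq_bigr => i _.
rewrite ud_dashv1 -scaleNr tsymbolD tsymbolZ fpsNE oppr0 scale0r addr0.
by rewrite !tsymbol_htens lp_scaleE symbolM symbol_gen mulrC.
Qed.

(** Appending a letter z changes the correction W into W -| (1 ox z) plus the
    new bracket term; after taking symbols this is the Leibniz rule. *)
Lemma dashv_word G y (zs : seq L) : exists2 W,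
  foldl (fun a z => ud_dashv D a (htens 1 z)) (htens G y) zs
    = htens (G * \prod_(z <- zs) Uh_gen (bar z)) y - (hbar : fps K) *: W
  & tsymbol W
    = lp_scale (symbol G) (lp_act (\prod_(z <- zs) symv (bar z)) y).
Proof.
elim/last_ind: zs => [|zs z [W eW sW]].
  exists 0; first by rewrite big_nil mulr1 scaler0 subr0.
  rewrite big_nil lp_act1l lp_scale0.
  exact: tsymbol0.
rewrite foldl_rcons eW linearBl linearZl_LR ud_dashv1 !big_rcons /=.
set P := \prod_(_ <- _) Uh_gen _; set p := \prod_(_ <- _) symv _.
have sP : symbol P = p by exact: symbol_word.
exists (htens (G * P) (lbr z y) + ud_dashv D W (htens 1 z)).
  by rewrite scalerDr opprD addrA mulrA.
rewrite tsymbolD tsymbol_htens tsymbol_dashv1 sW lp_actMr lp_scaleDr.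
by rewrite lp_scaleE !lp_scaleA symbolM sP addrC [symv _ * _]mulrC.
Qed.

(** The formula for -| modulo hbar^2, written with an exact remainder hbar W of
    which only the symbol is prescribed: this says the same without dividing by
    hbar. *)
Definition dashv_expansion F := forall G x y, exists2 W,
  ud_dashv D (htens G y) (htens F x)
    = htens (G * F * Uh_gen (bar x)) y - (hbar : fps K) *: W
  & tsymbol W = lp_scale (symbol G) (lp_act (symbol F * symv (bar x)) y).

Lemma dashv_expansion_word (zs : seq L) :
  dashv_expansion (\prod_(z <- zs) Uh_gen (bar z)).
Proof.
move=> G x y; rewrite ud_dashv_prod.
have [W -> sW] := dashv_word G y (rcons zs x).
exists W; first by rewrite big_rcons mulrA.
by rewrite sW big_rcons symbol_word.
Qed.

Lemma dashv_expansionD F F' :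
  dashv_expansion F -> dashv_expansion F' -> dashv_expansion (F + F').
Proof.
move=> eF eF' G x y; have [[W e s] [W' e' s']] := (eF G x y, eF' G x y).
exists (W + W').
  by rewrite htensDl linearDr e e' mulrDr mulrDl htensDl scalerDr opprD addrACA.
by rewrite tsymbolD s s' symbolD mulrDl lp_actDl lp_scaleDr.
Qed.

(** Scalars are central in [Uh].  The isomorphism I is injective, so this can be
    checked in the star algebra, whose product is bilinear. *)
Lemma UhZAr (c : fps K) F G : c *: (F * G) = F * (c *: G).
Proof.
apply: (can_inj (sisoK I)).
by rewrite sisoM linearZ /= sisoM linearZ /= linearZr_LR.
Qed.

Lemma dashv_expansionZ c F : dashv_expansion F -> dashv_expansion (c *: F).
Proof.
move=> eF G x y; have [W e s] := eF G x y.
exists (c *: W).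
  rewrite htensZl linearZr_LR e -UhZAr -scalerAl htensZl scalerBr.
  by rewrite !scalerA [hbar * c]mulrC.
by rewrite tsymbolZ s symbolZ -scalerAl lp_actZl lp_scaleZr.
Qed.
End Env.

(** * Elements of the completed enveloping algebra modulo hbar *)

Section Envel.
Variables (K : fieldType) (L : finLodayType K).

Definition Uh_of (s : tensorAlg L) : Uh L := \pi_(Uh L) (fpsC s).

Lemma Uh_ofD s t : Uh_of (s + t) = Uh_of s + Uh_of t.
Proof. by rewrite /Uh_of fpsCD Uh_piD. Qed.

Lemma Uh_ofZ (c : K) s : Uh_of (c *: s) = (fpsC c : fps K) *: Uh_of s.
Proof.
rewrite -[RHS]Uh_piZ; congr (\pi_(Uh L) _).
by apply/funext => n; rewrite fpsCZE; case: n => [|n] //=; rewrite scaler0.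
Qed.

Lemma Uh_ofM s t : Uh_of (s * t) = Uh_of s * Uh_of t.
Proof.
rewrite -[RHS]Uh_piM; congr (\pi_(Uh L) _); apply/funext => n.
rewrite fpsME big_ord_recl subn0 big1 => [|i _]; last by rewrite mul0r.
by rewrite addr0; case: n => [|n] //=; rewrite mulr0.
Qed.

Lemma tensorv_basis (i : 'I_(nLie L)) :
  tensorv (vbasis {: gLie L})`_i = << fmu i >>.
Proof.
rewrite /tensorv (bigD1 i) //= coord_free ?(basis_free (vbasisP _)) // eqxx.
rewrite scale1r big1 ?addr0 // => j ji.
rewrite coord_free ?(basis_free (vbasisP _)) //.
by rewrite [i == j]eq_sym (negPf ji) scale0r.
Qed.

Lemma Uh_of_word (w : {fmonom 'I_(nLie L)}) :
  Uh_of << w >>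
    = \prod_(z <- [seq repr (vbasis {: gLie L})`_i | i : 'I_(nLie L) <- w])
        Uh_gen (bar z).
Proof.
case: w => w; elim: w => [|i w IH].
  rewrite big_nil; congr (\pi_(Uh L) (fpsC _)).
  by rewrite -fmE.
have -> : << FMonom (i :: w) >> = << fmu i >> * << FMonom w >> :> tensorAlg L.
  rewrite [RHS]malgM_def fgmulUU mulr1; congr (<< _ *g _ >>).
  by apply: val_inj; rewrite /= fmM fmU.
by rewrite Uh_ofM IH big_cons bar_repr -tensorv_basis.
Qed.

(** Modulo hbar, the completed enveloping algebra is spanned by words in the
    generators: the constant term of a series over the free algebra is a finite
    combination of words.  Any property P of words that is stable under linear
    combinations therefore holds for some A congruent to F. *)
Lemma Uh_split_hbar (P : Uh L -> Prop) :
    (forall zs : seq L, P (\prod_(z <- zs) Uh_gen (bar z))) ->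
    (forall F G, P F -> P G -> P (F + G)) ->
    (forall (c : K) F, P F -> P ((fpsC c : fps K) *: F)) ->
  forall F, exists2 A, P A & exists F', F = A + (hbar : fps K) *: F'.
Proof.
move=> Pw PD PZ F; set s : tensorAlg L := repr F 0%N.
exists (Uh_of s); last first.
  exists (\pi_(Uh L) (fps_shift (repr F))).
  by rewrite -[LHS]reprK {1}[repr F](fps_split) Uh_piD Uh_piZ.
have Uh_of0 : Uh_of 0 = 0.
  by rewrite -(scale0r (0 : tensorAlg L)) Uh_ofZ fpsC0 scale0r.
have P0 : P 0.
  rewrite -(scale0r (1 : Uh L)) -fpsC0; apply: (PZ).
  by have := Pw [::]; rewrite big_nil.
rewrite [s]monalgE (big_morph _ Uh_ofD Uh_of0).
elim/big_rec: _ => // w u _; apply: PD.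
have -> : << monalg.mcoeff w s *g w >>
    = monalg.mcoeff w s *: << w >> :> tensorAlg L.
  by rewrite -mul_malgC malgM_def fgmulUU mulr1 mul1m.
by rewrite Uh_ofZ Uh_of_word; apply: PZ.
Qed.
End Envel.

(** * The classical limit *)

Section Limits.
Variables (K : fieldType) (L : finLodayType K).
Variables (st : star_product L) (I : star_iso st) (D : env_dialgebra L).
Implicit Types (F G : Uh L) (x y z : L).

Lemma dashv_expansion_mod_hbar F :
  exists2 A, dashv_expansion I D A & exists F', F = A + (hbar : fps K) *: F'.
Proof.
apply: Uh_split_hbar; first exact: dashv_expansion_word.
  exact: dashv_expansionD.
by move=> c; apply: dashv_expansionZ.
Qed.

(** First round of the bootstrap.  The contribution of hbar F' to both sides is
    a multiple of hbar, so it is absorbed into W, whose symbol is left free. *)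
Lemma dashv_mod_hbar F G x y : exists W,
  ud_dashv D (htens G y) (htens F x)
    = htens (G * F * Uh_gen (bar x)) y - (hbar : fps K) *: W.
Proof.
have [A eA [F' ->]] := dashv_expansion_mod_hbar F.
have [W e _] := eA G x y.
exists (W + htens (G * F' * Uh_gen (bar x)) y
        - ud_dashv D (htens G y) (htens F' x)).
rewrite htensDl linearDr e htensZl linearZr_LR.
rewrite mulrDr -(UhZAr I) mulrDl -scalerAl htensDl htensZl.
rewrite scalerBr scalerDr !opprD opprK !addrA; congr (_ + _).
by rewrite [RHS]addrAC addrK.
Qed.

(** Second round.  The previous lemma for F' gives a remainder hbar W for
    hbar F'; its symbol is 0, as is the symbol of hbar F'. *)
Lemma dashv_expansionP F : dashv_expansion I D F.
Proof.
have [A eA [F' ->]] := dashv_expansion_mod_hbar F.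
apply: dashv_expansionD => // G x y.
have [W e] := dashv_mod_hbar F' G x y; exists ((hbar : fps K) *: W).
  by rewrite htensZl linearZr_LR e scalerBr -(UhZAr I) -scalerAl htensZl.
rewrite tsymbolZ symbolZ !scale0r mul0r.
by rewrite -(scale0r (0 : Sym L)) lp_actZl scale0r lp_scale0.
Qed.

(** The inverse of I is only a function; its linearity is inherited from I. *)
Lemma tens_map_siso_inv (f : fps (Sym L)) x :
  tens_map (siso_inv I) (htens f x) = htens (siso_inv I f) x.
Proof.
rewrite -{1}[f](siso_invK I) -(tens_map_htens I).
by apply/ffunP => i; rewrite [LHS]ffunE [in LHS]ffunE sisoK.
Qed.

Lemma hlim0_htens (f : fps (Sym L)) x : hlim0 (htens f x) = tens (f 0%N) x.
Proof. by apply/ffunP => i; rewrite !ffunE fpsCZE. Qed.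

Lemma star_vdashE (f g : fps (Sym L)) x y :
  star_vdash I D (htens f x) (htens g y)
    = htens (st (st f (fpsC (symv (bar x)))) g) y.
Proof.
rewrite /star_vdash /star_transport !tens_map_siso_inv ud_vdashE tens_map_htens.
by rewrite !sisoM siso_gen !siso_invK.
Qed.

Lemma star_dashvE (f g : fps (Sym L)) x y : exists2 w : tensor (fps (Sym L)) L,
  star_dashv I D (htens g y) (htens f x)
    = htens (st g (st f (fpsC (symv (bar x))))) y - (hbar : fps K) *: w
  & hlim0 w
    = lp_scale (g 0%N) (lp_act (f 0%N * symv (bar x)) y).
Proof.
rewrite /star_dashv /star_transport !tens_map_siso_inv.
have [W -> sW] := dashv_expansionP (siso_inv I f) (siso_inv I g) x y.
exists (tens_map I W); last first.
  have -> : hlim0 (tens_map I W) = tsymbol I W.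
    by apply/ffunP => i; rewrite !ffunE.
  by rewrite sW /symbol !siso_invK.
rewrite -mulrA -[in RHS](siso_invK I f) -[in RHS](siso_invK I g).
rewrite -(siso_gen I) -!sisoM -(tens_map_htens I).
by apply/ffunP => i; rewrite !ffunE linearB; congr (_ - _); rewrite linearZ.
Qed.

Lemma star_dicommE (f g : fps (Sym L)) x y : 2 != 0 :> K ->
  exists2 c : tensor (fps (Sym L)) L,
    star_dicomm I D (htens f x) (htens g y) = (hbar : fps K) *: c
  & hlim0 c = lp_bracket (tens (f 0%N) x) (tens (g 0%N) y).
Proof.
move=> two; rewrite /star_dicomm star_vdashE.
have [w dw hw] := star_dashvE f g x y; rewrite dw.
rewrite lp_bracketE lp_hamE -hw.
set h := st f _; have h0 : h 0%N = f 0%N * symv (bar x) by rewrite /h star0.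
set d := st h g - st g h.
have d0 : d 0%N = 0 by rewrite /d fpsDE fpsNE !star0 mulrC subrr.
exists (htens (fps_shift d) y + w).
  rewrite opprB scalerDr -htensZl -fps_hbarZ0 //.
  rewrite addrA addrAC; congr (_ + _).
  by apply/ffunP => i; rewrite !ffunE -scalerBr.
rewrite -h0 -(star_comm1 st h g two) -/d.
have hD a b : hlim0 (a + b) = hlim0 a + hlim0 b.
  by apply/ffunP => i; rewrite !ffunE.
by rewrite hD hlim0_htens.
Qed.
End Limits.

Unset Implicit Arguments.

Theorem proposition5p3 (R : realType) (k : ground)
    (L : finLodayType (ground_field R k))
    (st : star_product L) (I : star_iso st) (D : env_dialgebra L)
    (f g : fps (Sym L)) (x y : L) :
  hlim0 (star_vdash I D (htens f x) (htens g y))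
    = lp_mul (tens (f 0%N) x) (tens (g 0%N) y)
  /\ exists2 c : tensor (fps (Sym L)) L,
       star_dicomm I D (htens f x) (htens g y)
         = (hbar : fps (ground_field R k)) *: c
     & hlim0 c = lp_bracket (tens (f 0%N) x) (tens (g 0%N) y).
Proof.
split; first by rewrite star_vdashE hlim0_htens !star0 lp_mulE.
(* Both ground fields have characteristic 0, so 2 is invertible. *)
by apply: star_dicommE; case: k {L st I D f g x y}; rewrite Num.Theory.pnatr_eq0.
Qed.
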